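(* Let $I$ be a set of indices and $A=(A_{ij})_{i,j\in I}$ a $\{0,1\}$-matrix with no rows identically zero, and let $\mathsf{X}_A=\{(x_n)\in I^{\mathbb{N}}:A_{x_nx_{n+1}}=1\text{ for all }n\in\mathbb{N}\}$. Then the unital Exel-Laca algebra $\widetilde{\mathcal{O}}_A$ is isomorphic to the unital subshift C*-algebra $\widetilde{\mathcal{O}}_{\mathsf{X}_A}$.
   Context: The unital Exel-Laca algebra $\widetilde{\mathcal{O}}_A$ is the universal unital C*-algebra generated by partial isometries $\{S_i\}_{i\in I}$ such that: (EL1) $S_i^*S_iS_j^*S_j=S_j^*S_jS_i^*S_i$ for all $i,j\in I$; (EL2) $S_iS_i^*S_jS_j^*=0$ whenever $i\ne j$; (EL3) $S_i^*S_iS_jS_j^*=A_{ij}S_jS_j^*$ for all $i,j\in I$; (EL4) for all finite $X,Y\subseteq I$ such that $A(X,Y,j):=\prod_{x\in X}A_{xj}\prod_{y\in Y}(1-A_{yj})$ is zero for all but a finite number of $j$'s, $\prod_{x\in X}S_x^*S_x\prod_{y\in Y}(1-S_y^*S_y)=\sum_{j\in I}A(X,Y,j)S_jS_j^*$. For a subshift $\mathsf{X}$ over an alphabet $\mathscr{A}$ (here $\mathscr{A}=I$, $\mathsf{X}=\mathsf{X}_A$), $\mathcal{L}_{\mathsf{X}}$ is the set of all finite words occurring in elements of $\mathsf{X}$, including the empty word $\omega$. For $\alpha,\beta\in\mathcal{L}_{\mathsf{X}}$ put $C(\alpha,\beta)=\{\beta x\in\mathsf{X}:\alpha x\in\mathsf{X}\}$.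 $\mathcal{U}$ is the Boolean algebra of subsets of $\mathsf{X}$ generated by all $C(\alpha,\beta)$, $\alpha,\beta\in\mathcal{L}_{\mathsf{X}}$. $\widetilde{\mathcal{O}}_{\mathsf{X}}$ is the universal unital C*-algebra generated by projections $\{p_B:B\in\mathcal{U}\}$ and partial isometries $\{s_a:a\in\mathscr{A}\}$ subject to: (1) $p_{\mathsf{X}}=1$, $p_{B\cap C}=p_Bp_C$, $p_{B\cup C}=p_B+p_C-p_{B\cap C}$, $p_\emptyset=0$ for all $B,C\in\mathcal{U}$; (2) $s_\beta s_\alpha^*s_\alpha s_\beta^*=p_{C(\alpha,\beta)}$ for all $\alpha,\beta\in\mathcal{L}_{\mathsf{X}}$, where $s_\omega=1$ and $s_\alpha=s_{\alpha_1}\cdots s_{\alpha_n}$ for $\alpha=\alpha_1\cdots\alpha_n$. *)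

(* Defs.v *)
From HB Require Import structures.
From mathcomp Require Import all_boot all_order all_algebra.
From mathcomp Require Import finmap.
From mathcomp Require Import complex.
From mathcomp Require Import all_classical all_reals all_analysis.
Set Implicit Arguments.
Unset Strict Implicit.
Unset Printing Implicit Defensive.
Import Order.TTheory GRing.Theory Num.Theory numFieldNormedType.Exports.
Local Open Scope classical_set_scope.
Local Open Scope complex_scope.
Local Open Scope ring_scope.


(* The library has no structure joining rings and normed modules, so the
   product is part of the mixin, and the ring structure is recovered below. It
   is a [pzRingType] and the algebra may be zero: both universal algebras
   considered below are zero when the index set is empty. *)
HB.mixin Record isUnitalCstarAlgebra (R : realType) A
    of CompleteNormedModule R[i] A := {
  cstar_one : A;
  cstar_mul : A -> A -> A;
  star : A -> A;
  cstar_mulA : associative cstar_mul;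
  cstar_mul1l : left_id cstar_one cstar_mul;
  cstar_mul1r : right_id cstar_one cstar_mul;
  cstar_mulDl : left_distributive cstar_mul +%R;
  cstar_mulDr : right_distributive cstar_mul +%R;
  cstar_scalerAl : forall (k : R[i]) (x y : A),
    k *: cstar_mul x y = cstar_mul (k *: x) y;
  cstar_scalerAr : forall (k : R[i]) (x y : A),
    k *: cstar_mul x y = cstar_mul x (k *: y);
  cstar_normM : forall x y : A, `|cstar_mul x y| <= `|x| * `|y|;
  starK : involutive star;
  starD : {morph star : x y / x + y};
  starZ : forall (k : R[i]) (x : A), star (k *: x) = k^* *: star x;
  starM : forall x y : A, star (cstar_mul x y) = cstar_mul (star y) (star x);
  norm_starM : forall x : A, `|cstar_mul (star x) x| = `|x| ^+ 2
}.

#[short(type="unitalCstarAlgType")]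
HB.structure Definition UnitalCstarAlgebra (R : realType) :=
  {A of CompleteNormedModule R[i] A & isUnitalCstarAlgebra R A}.

HB.instance Definition _ (R : realType) (A : unitalCstarAlgType R) :=
  GRing.Zmodule_isPzRing.Build (UnitalCstarAlgebra.sort A)
    cstar_mulA cstar_mul1l cstar_mul1r cstar_mulDl cstar_mulDr.

Definition star_hom (R : realType) (A B : unitalCstarAlgType R)
    (f : A -> B) : Prop :=
  [/\ linear f, monoid_morphism f & {morph f : x / star x}].

Definition star_isomorphic (R : realType) (A B : unitalCstarAlgType R) : Prop :=
  exists2 f : A -> B, star_hom f & bijective f.

Section Elements.
Variables (R : realType) (A : unitalCstarAlgType R).

Definition projection (p : A) : Prop := star p = p /\ p * p = p.

Definition partial_isometry (s : A) : Prop := s * star s * s = s.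

End Elements.

Section ExelLaca.
Variables (I : choiceType) (M : I -> I -> bool).

Definition EL_coef (X Y : {fset I}) (j : I) : nat :=
  ((\prod_(x <- X) M x j) * (\prod_(y <- Y) (1 - M y j)))%N.

(* In [EL4] the factors commute by [EL1], so the products do not depend on the
   enumerations of [X] and [Y]; the sum over [I] is finitely supported. *)
Record EL_family (R : realType) (B : unitalCstarAlgType R) (S : I -> B) :
    Prop := {
  EL_isometry : forall i, partial_isometry (S i);
  EL1 : forall i j,
    star (S i) * S i * (star (S j) * S j)
    = star (S j) * S j * (star (S i) * S i);
  EL2 : forall i j, i <> j -> S i * star (S i) * (S j * star (S j)) = 0;
  EL3 : forall i j,
    star (S i) * S i * (S j * star (S j)) = (S j * star (S j)) *+ M i j;
  EL4 : forall X Y : {fset I},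
    finite_set [set j | EL_coef X Y j <> 0%N] ->
    (\prod_(x <- X) (star (S x) * S x)) *
    (\prod_(y <- Y) (1 - star (S y) * S y))
    = \sum_(j \in [set: I]) (S j * star (S j)) *+ EL_coef X Y j
}.

Definition universal_EL (R : realType) (O : unitalCstarAlgType R)
    (S : I -> O) : Prop :=
  EL_family S /\
  forall (B : unitalCstarAlgType R) (T : I -> B), EL_family T ->
    exists! f : O -> B, star_hom f /\ forall i, f (S i) = T i.

Definition matrix_shift : set (nat -> I) :=
  [set x | forall n, M (x n) (x n.+1)].

End ExelLaca.

Section Subshift.
Variables (I : Type) (X : set (nat -> I)).

(* [word_cat w x] is the infinite sequence [w] followed by [x]. *)
Definition word_cat (w : seq I) (x : nat -> I) : nat -> I :=
  foldr (fun a y n => if n is m.+1 then y m else a) x w.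

(* The empty word is added separately: it is in the language even if [X] is
   empty. *)
Definition language : set (seq I) :=
  [set w | w = [::] \/
    exists x k n, X x /\ w = mkseq (fun i => x (k + i)%N) n].

Definition cylinder (alpha beta : seq I) : set (nat -> I) :=
  [set y | X y /\ exists x, y = word_cat beta x /\ X (word_cat alpha x)].

Definition boolean_algebra_of_subsets (F : set (set (nat -> I))) : Prop :=
  [/\ F `<=` [set B | B `<=` X], F set0 /\ F X,
      forall B C, F B -> F C -> F (B `&` C),
      forall B C, F B -> F C -> F (B `|` C) &
      forall B, F B -> F (X `\` B)].

Definition subshift_algebra : set (set (nat -> I)) :=
  smallest boolean_algebra_of_subsets
    [set B | exists alpha beta,
       [/\ language alpha, language beta & B = cylinder alpha beta]].

Definition word_prod (R : realType) (B : unitalCstarAlgType R) (s : I -> B)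
    (w : seq I) : B := \prod_(a <- w) s a.

(* The generators [p] are indexed by [subshift_algebra]; the values of [p]
   elsewhere are ignored, here and in [universal_subshift]. *)
Record subshift_family (R : realType) (B : unitalCstarAlgType R)
    (p : set (nat -> I) -> B) (s : I -> B) : Prop := {
  subshift_projection : forall C, subshift_algebra C -> projection (p C);
  subshift_isometry : forall a, partial_isometry (s a);
  subshift_pT : p X = 1;
  subshift_pI : forall C D, subshift_algebra C -> subshift_algebra D ->
    p (C `&` D) = p C * p D;
  subshift_pU : forall C D, subshift_algebra C -> subshift_algebra D ->
    p (C `|` D) = p C + p D - p (C `&` D);
  subshift_p0 : p set0 = 0;
  subshift_word : forall alpha beta, language alpha -> language beta ->
    word_prod s beta * star (word_prod s alpha) * word_prod s alpha
      * star (word_prod s beta) = p (cylinder alpha beta)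
}.

Definition universal_subshift (R : realType) (O : unitalCstarAlgType R)
    (p : set (nat -> I) -> O) (s : I -> O) : Prop :=
  subshift_family p s /\
  forall (B : unitalCstarAlgType R) (q : set (nat -> I) -> B) (t : I -> B),
    subshift_family q t ->
    exists! f : O -> B,
      [/\ star_hom f, forall C, subshift_algebra C -> f (p C) = q C &
          forall a, f (s a) = t a].

End Subshift.

(* Main.v *)
Require Import Defs.
From mathcomp Require Import all_boot all_order all_algebra.
From mathcomp Require Import finmap.
From mathcomp Require Import all_classical all_reals all_analysis.
Set Implicit Arguments.
Unset Strict Implicit.
Unset Printing Implicit Defensive.
Import GRing.Theory.
Local Open Scope classical_set_scope.
Local Open Scope ring_scope.

(** Write [X] for the shift space of the matrix [M].  Each of the two universal
    algebras carries the generators and relations of the other, so the two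
    universal properties give homomorphisms in both directions, and these are
    mutually inverse because homomorphisms are determined by the partial
    isometries.

    From a subshift family to an Exel-Laca family.  The projection [s_i^* s_i]
    is the value of [p] at the set of [x] in [X] with [M i (x 0)], because that
    set is [C(i, omega)], and [s_i s_i^*] is its value at the set of [x]
    starting with [i], which is [C(omega, i)].  The four Exel-Laca relations
    then become identities between sets ([subshift_EL_family]).  The absence
    of zero rows makes every letter the start of a point of [X].

    From an Exel-Laca family [T] to a subshift family.  What has to be built is
    a Boolean homomorphism from the algebra generated by the cylinders to
    projections.  As [X] is a one-step shift, a cylinder [C(alpha, beta)]
    depends only on [beta] and on the last letter [c] of [alpha], and its image
    must be [T_beta T_c^* T_c T_beta^*].  These elements are commuting
    projections, so every Boolean formula in the cylinders has a set of
    solutions in [X] and a value in the algebra.  The value depends only on the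
    set of solutions as soon as an unsatisfiable formula has value zero
    ([eval_unsat], [eval_ext]); then the value is the required function of the
    set ([EL_subshift_family]).

    To see that an unsatisfiable formula [f] has value [e = 0], read points
    letter by letter.  Multiplying [e] on the right by [T_a] moves it across
    [T_a] and turns [f] into the formula satisfied by the [x] with [a x] in the
    solutions of [f], in which all words are shorter; so [e T_a = 0] by
    induction on their length.  Hence [e] is orthogonal to all [T_a T_a^*].
    Off the finitely many letters that begin a word of [f], the formula
    involves only the projections [T_c^* T_c] for finitely many [c].  On each
    product of these projections and of their complements the formula is
    constantly true or constantly false.  If it is false, [e] vanishes there;
    if it is true, unsatisfiability forces all but finitely many letters out
    of the product, which by (EL4) is then a finite sum of projections
    [T_a T_a^*], all orthogonal to [e] ([eval_eq0_of_letters]). *)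

(** * Boolean formulas and their values in a ring *)

Inductive bool_formula (J : Type) : Type :=
| BVar of J
| BNot of bool_formula J
| BAnd of bool_formula J & bool_formula J.

Section BooleanFormulas.
Variable J : Type.
Implicit Types (f g : bool_formula J) (B : pzRingType).

Fixpoint vars f : seq J :=
  match f with
  | BVar j => [:: j]
  | BNot f => vars f
  | BAnd f g => vars f ++ vars g
  end.

Fixpoint sat (v : J -> bool) f : bool :=
  match f with
  | BVar j => v j
  | BNot f => ~~ sat v f
  | BAnd f g => sat v f && sat v g
  end.

Fixpoint ring_eval B (u : J -> B) f : B :=
  match f with
  | BVar j => u j
  | BNot f => 1 - ring_eval u f
  | BAnd f g => ring_eval u f * ring_eval u g
  end.

Fixpoint subst (h : J -> bool_formula J) f : bool_formula J :=
  match f with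
  | BVar j => h j
  | BNot f => BNot (subst h f)
  | BAnd f g => BAnd (subst h f) (subst h g)
  end.

Lemma sat_subst v h f : sat v (subst h f) = sat (fun j => sat v (h j)) f.
Proof. by elim: f => //= [f ->|f -> g ->]. Qed.

Lemma ring_eval_subst B (u : J -> B) h f :
  ring_eval u (subst h f) = ring_eval (fun j => ring_eval u (h j)) f.
Proof. by elim: f => //= [f ->|f -> g ->]. Qed.

Lemma ring_eval_bool B (v : J -> bool) f :
  ring_eval (fun j => (v j)%:R : B) f = (sat v f)%:R.
Proof.
elim: f => //= [f ->|f -> g ->]; last by rewrite -natrM mulnb.
by case: (sat v f); rewrite ?subrr ?subr0.
Qed.

Lemma commr_ring_eval B (u : J -> B) (w : B) f :
  (forall j, GRing.comm w (u j)) -> GRing.comm w (ring_eval u f).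
Proof.
move=> uC; elim: f => //= [f|f ? g ?]; last exact: commrM.
by move=> ?; apply: commrB => //; exact: commr1.
Qed.

Lemma ring_eval_idem B (u : J -> B) f : (forall i j, GRing.comm (u i) (u j)) ->
  (forall j, u j * u j = u j) -> ring_eval u f * ring_eval u f = ring_eval u f.
Proof.
move=> uC uu; have C g h : GRing.comm (ring_eval u g) (ring_eval u h).
  by apply: commr_ring_eval => j; apply/commr_sym/commr_ring_eval => i;
    exact: uC.
elim: f => //= [f IH|f IHf g IHg].
  by rewrite mulrBl mul1r mulrBr mulr1 IH subrr subr0.
by rewrite mulrA -(mulrA (ring_eval u f)) (C g f) mulrA IHf -mulrA IHg.
Qed.

End BooleanFormulas.

Lemma eq_sat (J : eqType) (v v' : J -> bool) f :
  {in vars f, v =1 v'} -> sat v f = sat v' f.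
Proof.
elim: f => /= [t|f IH|f IHf g IHg] vv; first by apply: vv; rewrite inE.
  by rewrite IH.
by rewrite IHf ?IHg// => t tf; apply: vv; rewrite mem_cat tf ?orbT.
Qed.

(** Both the substitution of a first letter and the evaluation of a formula by
    truth values on a product of projections are instances: in either case an
    element [w] transports the variables from one assignment to another. *)
Lemma ring_eval_intertwine (J : eqType) (B : pzRingType) (u u' : J -> B)
    (w : B) f :
  (forall j, j \in vars f -> u j * w = w * u' j) ->
  ring_eval u f * w = w * ring_eval u' f.
Proof.
elim: f => /= [j|f IH|f IHf g IHg] H; first by apply: H; rewrite inE.
  by rewrite mulrBl mulrBr mul1r mulr1 IH.
rewrite -mulrA IHg; last by move=> j jg; apply: H; rewrite mem_cat jg orbT.
by rewrite mulrA IHf ?mulrA// => j jf; apply: H; rewrite mem_cat jf.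
Qed.

(** * Products of commuting idempotents *)

Section CommutingIdempotents.
Variables (J : eqType) (B : pzRingType) (u : J -> B).
Hypothesis uC : forall i j, GRing.comm (u i) (u j).
Hypothesis uu : forall j, u j * u j = u j.

Lemma prod_absorb (s : seq J) i : i \in s ->
  u i * \prod_(j <- s) u j = \prod_(j <- s) u j.
Proof.
elim: s => // k s IH; rewrite inE big_cons => /predU1P[->|/IH E].
  by rewrite mulrA uu.
by rewrite mulrA uC -mulrA E.
Qed.

Lemma prod_sub_absorb (s t : seq J) : {subset s <= t} ->
  \prod_(j <- s) u j * \prod_(j <- t) u j = \prod_(j <- t) u j.
Proof.
elim: s => [|i s IH] st; first by rewrite big_nil mul1r.
rewrite big_cons -mulrA IH ?prod_absorb ?st ?mem_head// => k ks.
by rewrite st// inE ks orbT.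
Qed.

(** Neither order nor multiplicity of the factors matters, since each of the two
    products absorbs the other. *)
Lemma eq_mem_prod (s t : seq J) : s =i t ->
  \prod_(j <- s) u j = \prod_(j <- t) u j.
Proof.
move=> st; rewrite -(@prod_sub_absorb t s)
  ?(@commr_prod _ _ _ _ _ (\prod_(j <- t) u j)).
  by rewrite prod_sub_absorb// => j; rewrite st.
by move=> i _; apply/commr_sym/commr_prod => j _; exact: uC.
by move=> j; rewrite st.
Qed.

End CommutingIdempotents.

(** The unit is the sum of the products below over all [nu] on [G], as is seen
    by expanding the product of the factors [u g + (1 - u g)]. *)
Lemma minterm_ext (I : eqType) (B : pzRingType) (u : I -> B) (G : seq I)
    (z : B) :
  uniq G ->
  (forall nu : I -> bool,
     z * \prod_(g <- G) (if nu g then u g else 1 - u g) = 0) ->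
  z = 0.
Proof.
elim: G z => [|g G IH] z /=.
  by move=> _ /(_ xpredT); rewrite big_nil mulr1.
move=> /andP[gG Gu] H.
suff zb b : z * (if b then u g else 1 - u g) = 0.
  by rewrite -(mulr1 z) -(subrK (u g) 1) mulrDr (zb true) (zb false) addr0.
apply: IH => // nu.
have := H [eta nu with g |-> b]; rewrite big_cons /= eqxx mulrA => E.
rewrite -[RHS]E; congr *%R.
rewrite big_seq [RHS]big_seq; apply: eq_bigr => h hG.
by case: eqP => // hg; rewrite -hg hG in gG.
Qed.
(** * Involutions and homomorphisms *)

Section StarRing.
Variables (R : realType) (B : unitalCstarAlgType R).
Implicit Types x y : B.

Lemma star_mul x y : star (x * y) = star y * star x.
Proof. exact: starM. Qed.

Lemma star1 : star (1 : B) = 1.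
Proof. by have := star_mul (star 1) 1; rewrite mulr1 starK mulr1. Qed.

Lemma star0 : star (0 : B) = 0.
Proof. by apply: (addIr (star 0)); rewrite -starD !add0r. Qed.

Lemma starN x : star (- x) = - star x.
Proof. by apply: (addIr (star x)); rewrite -starD !addNr star0. Qed.

Lemma starB x y : star (x - y) = star x - star y.
Proof. by rewrite starD starN. Qed.

Lemma star_ring_eval (J : Type) (u : J -> B) f :
  (forall i j, GRing.comm (u i) (u j)) -> (forall j, star (u j) = u j) ->
  star (ring_eval u f) = ring_eval u f.
Proof.
move=> uC us; elim: f => //= [f IH|f IHf g IHg].
  by rewrite starB star1 IH.
rewrite star_mul IHf IHg; apply: commr_ring_eval => j.
exact/commr_sym/commr_ring_eval.
Qed.

End StarRing.

Section StarHom.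
Variables (R : realType) (A B : unitalCstarAlgType R) (f : A -> B).
Hypothesis fhom : star_hom f.

Let f_lin := let: And3 h _ _ := fhom in h.
Let f_mon := let: And3 _ h _ := fhom in h.

Lemma star_homB x y : f (x - y) = f x - f y.
Proof.
have := f_lin (-1) y x; rewrite !scaleN1r => E.
by rewrite [x - y]addrC E addrC.
Qed.

Lemma star_homD x y : f (x + y) = f x + f y.
Proof. by have := f_lin 1 x y; rewrite !scale1r. Qed.

Lemma star_hom0 : f 0 = 0.
Proof. by rewrite -(subrr 0) star_homB subrr. Qed.

Lemma star_homM x y : f (x * y) = f x * f y.
Proof. by case: f_mon => _; apply. Qed.

Lemma star_hom1 : f 1 = 1.
Proof. by case: f_mon. Qed.

Lemma star_hom_star x : f (star x) = star (f x).
Proof. by case: fhom => _ _; apply. Qed.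

Lemma star_hom_word (J : choiceType) (s : J -> A) w :
  f (word_prod s w) = word_prod (f \o s) w.
Proof.
rewrite /word_prod; elim: w => [|a w IH]; first by rewrite !big_nil star_hom1.
by rewrite !big_cons star_homM IH.
Qed.

End StarHom.

Lemma star_hom_id (R : realType) (A : unitalCstarAlgType R) :
  star_hom (@idfun A).
Proof. by []. Qed.

Lemma star_hom_comp (R : realType) (A B C : unitalCstarAlgType R)
    (g : B -> C) (f : A -> B) :
  star_hom g -> star_hom f -> star_hom (g \o f).
Proof.
move=> [gl [g1 gm] gs] [fl [f1 fm] fs]; split.
- by move=> k x y /=; rewrite fl gl.
- by split=> [|x y] /=; [rewrite f1 g1|rewrite fm gm].
- by move=> x /=; rewrite fs gs.
Qed.

(** * Cylinders of a one-step shift *)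

Section Atoms.
Variables (I : choiceType) (M : I -> I -> bool).
Local Notation X := (matrix_shift M).
Local Notation atom := (option I * seq I)%type.

(** [None] stands for the last letter of the empty word, after which every
    letter is allowed. *)
Definition follows (o : option I) (i : I) : bool :=
  if o is Some c then M c i else true.

(** The boolean form, by recursion on [w], of: [y] is [w] followed by a sequence
    whose first letter is allowed after [o].  Being boolean it can serve as a
    truth assignment, and the recursion makes removing a first letter
    compute. *)
Fixpoint atom_sat_rec (o : option I) (w : seq I) (y : nat -> I) : bool :=
  if w is b :: w' then (y 0%N == b) && atom_sat_rec o w' (fun n => y n.+1)
  else follows o (y 0%N).

Definition atom_sat (y : nat -> I) (t : atom) : bool := atom_sat_rec t.1 t.2 y.

Definition prepend (a : I) (x : nat -> I) : nat -> I := word_cat [:: a] x.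

Definition olast (w : seq I) : option I :=
  if w is a :: w' then Some (last a w') else None.

Lemma matrix_shift_prepend a x : X (prepend a x) <-> M a (x 0%N) /\ X x.
Proof.
split=> [aX|[ax xX] [|n]] //=; last exact: xX.
by split=> [|n]; [exact: (aX 0%N)|exact: (aX n.+1)].
Qed.

Lemma matrix_shift_word_cat w x : sorted M w ->
  X (word_cat w x) <-> follows (olast w) (x 0%N) /\ X x.
Proof.
case: w => [|a w] /=; first by move=> _; split=> [|[]].
elim: w a => [|b w IH] a; first by move=> _; exact: matrix_shift_prepend.
move=> /andP[ab bw].
apply: (iff_trans (matrix_shift_prepend a (word_cat (b :: w) x))).
rewrite [word_cat _ _ _]/= ab.
by split=> [[_ /(IH _ bw)]|/(IH _ bw)].
Qed.

Lemma language_sorted w : language X w -> sorted M w.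
Proof.
move=> [->//|[x [k [n [xX ->]]]]]; apply/(sortedP (x 0%N)) => i.
rewrite size_mkseq => lt_i; rewrite !nth_mkseq ?(ltnW lt_i)// addnS; exact: xX.
Qed.

Lemma atom_sat_word_cat o w x :
  atom_sat_rec o w (word_cat w x) = follows o (x 0%N).
Proof. by elim: w => //= b w IH; rewrite eqxx. Qed.

Lemma atom_sat_split o w y : atom_sat_rec o w y -> exists2 x, y = word_cat w x &
  follows o (x 0%N).
Proof.
elim: w y => [|b w IH] y /=; first by exists y.
move=> /andP[/eqP <- /IH[x yx ox]]; exists x => //.
by apply/funext => -[|n] //; rewrite -yx.
Qed.

Lemma matrix_shift_suffix w x : X (word_cat w x) -> X x.
Proof. by elim: w => //= b w IH /matrix_shift_prepend[_ /IH]. Qed.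

Definition atom_set (o : option I) (w : seq I) : set (nat -> I) :=
  [set y | X y /\ atom_sat_rec o w y].

(** One-step memory: prefixing a word to [x] stays in the shift as soon as its
    last letter fits the first letter of [x]. *)
Lemma cylinderE alpha beta : sorted M alpha ->
  cylinder X alpha beta = atom_set (olast alpha) beta.
Proof.
move=> aS; apply/seteqP; split=> y [yX].
  move=> [x [yE /(matrix_shift_word_cat _ aS)[ox _]]].
  by split=> //; rewrite yE atom_sat_word_cat.
move=> /atom_sat_split[x yE ox]; split=> //; exists x; split=> //.
apply/(matrix_shift_word_cat _ aS); split=> //.
by apply: (@matrix_shift_suffix beta); rewrite -yE.
Qed.

Lemma EL_coefE (U V : {fset I}) j :
  EL_coef M U V j = (all (M^~ j) U && all (fun y => ~~ M y j) V) :> nat.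
Proof.
rewrite /EL_coef -mulnb; congr muln; elim: (enum_fset _) => [|i s IH].
- by rewrite big_nil.
- by rewrite big_cons IH /= -mulnb.
- by rewrite big_nil.
- by rewrite big_cons IH /= -mulnb; case: (M i j).
Qed.

Section Points.
Hypothesis no_zero_row : forall i, exists j, M i j.

Lemma matrix_shift_start i : exists2 x, X x & x 0%N = i.
Proof.
have [nxt nxtP] := choice no_zero_row.
by exists (fun n => iter n nxt i) => // n /=.
Qed.

Lemma language_letter i : language X [:: i].
Proof.
right; have [x xX <-] := matrix_shift_start i.
by exists x, 0%N, 1%N; split.
Qed.

End Points.

End Atoms.

(** * The subshift family of an Exel-Laca family *)

Section ExelLacaToSubshift.
Variables (R : realType) (I : choiceType) (M : I -> I -> bool).
Variables (B : unitalCstarAlgType R) (T : I -> B).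
Hypothesis no_zero_row : forall i, exists j, M i j.
Hypothesis elT : EL_family M T.
Local Notation X := (matrix_shift M).
Local Notation atom := (option I * seq I)%type.
Local Notation Q i := (star (T i) * T i).
Local Notation P i := (T i * star (T i)).

Lemma source_star i : star (Q i) = Q i.
Proof. by rewrite star_mul starK. Qed.

Lemma range_mul i : P i * T i = T i.
Proof. exact: (EL_isometry elT i). Qed.

Lemma star_mul_range i : star (T i) * P i = star (T i).
Proof. by rewrite -[RHS](congr1 star (range_mul i)) !star_mul starK mulrA. Qed.

Lemma mul_source i : T i * Q i = T i.
Proof. by rewrite mulrA range_mul. Qed.

Lemma source_mul i j : Q i * T j = T j *+ M i j.
Proof. by rewrite -[T j in LHS]range_mul mulrA (EL3 elT) mulrnAl range_mul. Qed.

Lemma star_mul_source i j : star (T j) * Q i = star (T j) *+ M i j.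
Proof.
rewrite -(source_star i) -star_mul source_mul.
by case: (M i j); rewrite ?mulr1n ?mulr0n ?star0.
Qed.

Lemma star_mul_neq i j : i <> j -> star (T i) * T j = 0.
Proof.
move=> ij; rewrite -star_mul_range -[T j]range_mul -mulrA (mulrA (P i))
  (EL2 elT ij).
by rewrite mul0r mulr0.
Qed.

(** For [w] with product [T_w] and [o = Some c] this is
    [T_w T_c^* T_c T_w^*], the image of a cylinder; see [word_prod_conj]. *)
Fixpoint atom_elt_rec (o : option I) (w : seq I) : B :=
  if w is b :: w' then T b * atom_elt_rec o w' * star (T b)
  else if o is Some c then Q c else 1.

Definition atom_elt (t : atom) : B := atom_elt_rec t.1 t.2.

Lemma conj_mul b e f : T b * e * star (T b) * (T b * f * star (T b)) =
  T b * (e * Q b * f) * star (T b).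
Proof. by rewrite !mulrA. Qed.

Lemma source_comm_atom i o w : GRing.comm (Q i) (atom_elt_rec o w).
Proof.
case: w => [|b w] /=; last first.
  rewrite /GRing.comm -!mulrA star_mul_source !mulrA source_mul.
  by rewrite !mulrnAr !mulrnAl.
by case: o => [c|]; [exact: (EL1 elT)|exact: commr1].
Qed.

(** Two words with different first letters have orthogonal atoms.  If they share
    the first letter [b], removing it leaves the inductive case, up to a factor
    [T_b^* T_b] that commutes with all atoms. *)
Lemma atom_comm t t' : GRing.comm (atom_elt t) (atom_elt t').
Proof.
case: t t' => [r w] [r' w']; rewrite /atom_elt /=.
elim: w w' => [|b w IH] [|b' w'].
- case: r => [c|] /=; last exact/commr_sym/commr1.
  by case: r' => [c'|]; [exact: (EL1 elT)|exact: commr1].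
- case: r => [c|]; last exact/commr_sym/commr1.
  exact: (@source_comm_atom c r' (b' :: w')).
- clear IH; case: r' => [c|]; last exact: commr1.
  exact/commr_sym/(@source_comm_atom c r (b :: w)).
rewrite /GRing.comm /=; have [<-|/eqP bb'] := eqVneq b b'.
  rewrite !conj_mul; congr (_ * _ * _).
  by rewrite -(source_comm_atom b) -mulrA IH mulrA source_comm_atom.
rewrite -!mulrA (mulrA (star (T b)) (T b')) (mulrA (star (T b')) (T b)).
by rewrite (star_mul_neq bb') (star_mul_neq (nesym bb')) !mul0r !mulr0.
Qed.

Lemma atom_idem t : atom_elt t * atom_elt t = atom_elt t.
Proof.
case: t => o w; rewrite /atom_elt /=; elim: w => [|b w IH] /=.
  by case: o => [c|]; rewrite ?mulr1// -mulrA mul_source.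
by rewrite conj_mul -source_comm_atom -[Q b * _ * _]mulrA IH mulrA mul_source.
Qed.

Lemma atom_star t : star (atom_elt t) = atom_elt t.
Proof.
case: t => r w; rewrite /atom_elt /=; elim: w => [|b w IH] /=.
  by case: r => [c|]; rewrite ?star1// source_star.
by rewrite !star_mul starK IH mulrA.
Qed.

Local Notation formula := (bool_formula atom).
Local Notation E f := (ring_eval atom_elt f).
Local Notation btrue := (BVar (None, [::]) : formula).

(** The condition on [x] that [prepend a x] satisfies the atom [t]; see
    [sat_restrict]. *)
Definition restrict_atom (a : I) (t : atom) : formula :=
  match t.2 with
  | b :: w => if a == b then BVar (t.1, w) else BNot btrue
  | [::] => if follows M t.1 a then btrue else BNot btrue
  end.

Definition depth (f : formula) : nat := (\max_(t <- vars f) size t.2)%N.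

Lemma depth_restrict a f :
  (depth (subst (restrict_atom a) f) <= (depth f).-1)%N.
Proof.
rewrite /depth; elim: f => [[r [|b w]]|f IH|f IHf g IHg] //=.
- by rewrite /restrict_atom /=; case: (follows M r a); rewrite /= !big_seq1.
- by rewrite /restrict_atom /=; case: (a == b); rewrite /= !big_seq1.
rewrite !big_cat /= geq_max; apply/andP; split.
  by apply: (leq_trans IHf); rewrite -!subn1 leq_sub2r// leq_maxl.
by apply: (leq_trans IHg); rewrite -!subn1 leq_sub2r// leq_maxr.
Qed.

Lemma sat_restrict a x f :
  sat (atom_sat M x) (subst (restrict_atom a) f)
  = sat (atom_sat M (prepend a x)) f.
Proof.
rewrite sat_subst; elim: f => [[r [|b w]]|f /= ->|f /= -> g ->] //=.
  by rewrite /restrict_atom /atom_sat /=; case: (follows M r a).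
by rewrite /restrict_atom /atom_sat /=; case: (a == b).
Qed.

(** The algebraic counterpart of [sat_restrict]: [T a] plays the role of the map
    [prepend a]. *)
Lemma eval_restrict a f : E f * T a = T a * E (subst (restrict_atom a) f).
Proof.
rewrite ring_eval_subst; apply: ring_eval_intertwine => -[r [|b w]] _.
  rewrite /atom_elt; case: r => [c|] /=; last by rewrite mul1r mulr1.
  rewrite source_mul /restrict_atom /=; case: (M c a); first by rewrite mulr1.
  by rewrite /atom_elt /= subrr mulr0.
rewrite /restrict_atom /=; case: (eqVneq a b) => [<-|/eqP ab].
  rewrite /atom_elt /= -!mulrA.
  by rewrite -source_comm_atom [LHS]mulrA mul_source.
by rewrite /atom_elt /= -!mulrA star_mul_neq ?subrr ?mulr0//; exact: nesym.
Qed.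

Lemma eval_comm f g : GRing.comm (E f) (E g).
Proof.
apply: commr_ring_eval => t; apply/commr_sym/commr_ring_eval => t';
  exact: atom_comm.
Qed.

Lemma eval_idem f : E f * E f = E f.
Proof. by apply: ring_eval_idem; [exact: atom_comm|exact: atom_idem]. Qed.

Lemma eval_source_comm a f : GRing.comm (Q a) (E f).
Proof. exact: (eval_comm (BVar (Some a, [::])) f). Qed.

Lemma eval_star f : star (E f) = E f.
Proof. by apply: star_ring_eval; [exact: atom_comm|exact: atom_star]. Qed.

Definition unsat (f : formula) : Prop :=
  forall x, X x -> ~~ sat (atom_sat M x) f.

(** The second conjunct is there because [prepend a x] is a point of the shift
    only if [M a (x 0)]. *)
Lemma unsat_restrict a f : unsat f ->
  unsat (BAnd (subst (restrict_atom a) f) (BVar (Some a, [::]))).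
Proof.
move=> fU x xX; rewrite /= sat_restrict; apply/negP => /andP[fx ax].
by move/negP: (fU _ ((matrix_shift_prepend M a x).2 (conj ax xX))); exact.
Qed.

Definition literal (b : bool) (i : I) : B := if b then Q i else 1 - Q i.

Lemma source_idem i : Q i * Q i = Q i.
Proof. by rewrite -mulrA mul_source. Qed.

Lemma literal_comm b b' i i' : GRing.comm (literal b i) (literal b' i').
Proof.
have C : GRing.comm (Q i) (Q i') by exact: (EL1 elT).
have C' : GRing.comm (1 - Q i) (Q i').
  by apply/commr_sym/commrB; [exact: commr1|exact/commr_sym].
by case: b; case: b' => //; apply: commrB => //; exact: commr1.
Qed.

Lemma literal_idem b i : literal b i * literal b i = literal b i.
Proof.
case: b => /=; rewrite ?source_idem// mulrBl mul1r mulrBr mulr1.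
by rewrite source_idem subrr subr0.
Qed.

(** The left-hand side follows a list and mixes the two kinds of factors, the
    right-hand side has the shape of (EL4). *)
Lemma minterm_EL (G : seq I) (nu : I -> bool) :
  \prod_(g <- G) literal (nu g) g =
  (\prod_(x <- [fset x in G | nu x]%fset) Q x) *
  (\prod_(y <- [fset y in G | ~~ nu y]%fset) (1 - Q y)).
Proof.
pose u (l : I * bool) := literal l.2 l.1.
transitivity (\prod_(l <- [seq (g, nu g) | g <- G]) u l).
  by rewrite big_map.
transitivity (\prod_(l <- [seq (x, true) | x <- [fset x in G | nu x]%fset]
    ++ [seq (y, false) | y <- [fset y in G | ~~ nu y]%fset]) u l); last first.
  by rewrite big_cat !big_map.
apply: eq_mem_prod => [l l'|l|[g b]];
  [exact: literal_comm|exact: literal_idem|].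
rewrite mem_cat; apply/mapP/orP.
  move=> [h hG [-> ->]]; case: (boolP (nu h)) => nuh; [left|right]; apply/mapP;
  by exists h => //; rewrite !inE /= hG nuh.
by move=> [] /mapP[h]; rewrite !inE /= => /andP[hG nuh] [-> ->]; exists h => //;
  move: nuh => /=; case: (nu h).
Qed.

(** This is where (EL4) enters: being annihilated by every [T a] does not by
    itself make an element zero when the alphabet is infinite. *)
Lemma eval_eq0_of_letters f :
  unsat f -> (forall a, E f * T a = 0) -> E f = 0.
Proof.
move=> fU fT; have fP a : E f * P a = 0 by rewrite mulrA fT mul0r.
pose G := undup (pmap fst (vars f)).
pose F := undup (pmap (fun t : atom => ohead t.2) (vars f)).
have GP c w : (Some c, w) \in vars f -> c \in G.
  by move=> cf; rewrite mem_undup mem_pmap; apply/mapP; exists (Some c, w).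
have FP r b w : (r, b :: w) \in vars f -> b \in F.
  by move=> bf; rewrite mem_undup mem_pmap; apply/mapP; exists (r, b :: w).
apply: (@minterm_ext _ _ (fun i => Q i) G); first exact: undup_uniq.
move=> nu; set m := \prod_(g <- G) _.
(* The truth value of atoms at the points that start outside [F] and follow
   exactly those letters of [G] that [nu] selects. *)
pose v (t : atom) :=
  if t.2 is _ :: _ then false else if t.1 is Some c then nu c else true.
(* As [E f] is orthogonal to every [P b], the factor [r] does not change it,
   while it annihilates the atoms with a nonempty word. *)
pose r : B := 1 - \sum_(b <- F) P b.
have fr : E f * r = E f.
  by rewrite /r mulrBr mulr1 mulr_sumr big1 ?subr0// => b _.
have Pr b : b \in F -> P b * r = 0.
  move=> bF; rewrite /r mulrBr mulr1 mulr_sumr (bigD1_seq b) ?undup_uniq//=.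
  rewrite mulrA range_mul big1 ?addr0 ?subrr// => c /eqP cb.
  by apply: (EL2 elT); exact: nesym.
have Qr c : Q c * r = r * Q c.
  apply: commrB; first exact: commr1.
  rewrite /GRing.comm mulr_sumr mulr_suml; apply: eq_bigr => b _.
  by rewrite mulrA source_mul -mulrA star_mul_source mulrnAl mulrnAr.
have Qm c : c \in G -> Q c * m = (nu c)%:R * m.
  move=> cG; have := prod_absorb (fun i j => literal_comm (nu i) (nu j) i j)
    (fun i => literal_idem (nu i) i) cG.
  rewrite -/m /literal => <-.
  case: (nu c); rewrite /= [LHS]mulrA ?mulr1n ?mul1r ?source_idem//.
  by rewrite mulrBr mulr1 source_idem subrr mulr0n !mul0r.
have fm : E f * m = r * m * (sat v f)%:R.
  rewrite -fr -mulrA -ring_eval_bool.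
  apply: ring_eval_intertwine => -[q [|b w]] tf.
    rewrite /atom_elt /v; case: q tf => [c|] tf /=; last by rewrite mul1r mulr1.
    rewrite mulrA Qr -[LHS]mulrA Qm ?(GP _ _ tf)//.
    by case: (nu c); rewrite ?mul1r ?mulr1// mul0r !mulr0.
  have Tsr : star (T b) * r = 0.
    by rewrite -star_mul_range -mulrA Pr ?mulr0// (FP _ _ _ tf).
  by rewrite /v /= mulr0 /atom_elt /= mulrA -[_ * r]mulrA Tsr mulr0 mul0r.
case: (boolP (sat v f)) => [vf|/negbTE vf]; last by rewrite fm vf mulr0.
rewrite /m minterm_EL; set U := [fset x in G | _]%fset.
set V := [fset x in G | _]%fset.
(* A letter outside [F] in the support would start a solution of [f]. *)
have supp_F j : EL_coef M U V j <> 0%N -> j \in F.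
  move=> /eqP; rewrite EL_coefE eqb0 negbK => /andP[/allP jU /allP jV].
  apply: contraPT (fU) => jF;
  have [x xX x0] := matrix_shift_start no_zero_row j.
  move=> /(_ x xX); apply/negP; rewrite negbK -(@eq_sat _ v)//.
  move => -[q [|b w]] tf; rewrite /atom_sat /v /= x0.
    case: q tf => [c|] //= tf; apply/esym; have cG := GP _ _ tf.
    case: (boolP (nu c)) => nuc; first by apply: jU; rewrite !inE /= cG.
    by apply/negbTE/jV; rewrite !inE /= cG.
  by apply/esym; case: eqP => // jb; rewrite -(FP _ _ _ tf) -jb (negbTE jF).
have fin : finite_set [set j | EL_coef M U V j <> 0%N].
  apply: (@finite_subfset _ [fset j in F]%fset) => j /supp_F jF /=.
  by rewrite !inE.
rewrite (EL4 elT fin) (fsbigTE (fset_set [set j | EL_coef M U V j <> 0%N])).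
  by rewrite mulr_sumr big1// => j _; rewrite mulrnAr fP mul0rn.
move=> j; rewrite in_fset_set// notin_setE /= => /contrapT ->.
by rewrite mulr0n.
Qed.

(** Induction on the length of the words in [f]: removing a first letter
    shortens them, until all atoms only constrain the first letter. *)
Lemma eval_unsat f : unsat f -> E f = 0.
Proof.
have [n] := ex_intro (fun n => depth f <= n)%N _ (leqnn (depth f)).
elim: n f => [|n IH] f fn fU; apply: eval_eq0_of_letters => // a.
  have [x xX xa] := matrix_shift_start no_zero_row a.
  (* All words are empty, so that the truth of [f] depends on the first letter
     only, and any point starting with [a] decides it. *)
  suff -> : E f * T a = T a * (sat (atom_sat M x) f)%:R.
    by rewrite (negbTE (fU x xX)) mulr0.
  rewrite -ring_eval_bool; apply: ring_eval_intertwine => -[q [|b w]] tf.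
    rewrite /atom_elt /atom_sat; case: q tf => [c|] tf /=;
      last by rewrite mul1r mulr1.
    by rewrite source_mul xa; case: (M c a); rewrite ?mulr1 ?mulr0.
  have := leq_bigmax_seq (P := xpredT) (F := fun t : atom => size t.2)
    _ tf erefl.
  by rewrite -/(depth f) /= => /leq_trans/(_ fn).
have Qg : Q a * E (subst (restrict_atom a) f) = 0.
  rewrite eval_source_comm; apply: (IH _ _ (unsat_restrict a fU)).
  rewrite /depth /= big_cat big_seq1 /= maxn0.
  by apply: (leq_trans (depth_restrict a f)); rewrite -subn1 leq_subLR.
by rewrite eval_restrict -[X in X * _]mul_source -mulrA Qg mulr0.
Qed.

(** The formulas [f] and not [g], and [g] and not [f], are unsatisfiable. *)
Lemma eval_ext f g :
  (forall x, X x -> sat (atom_sat M x) f = sat (atom_sat M x) g) -> E f = E g.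
Proof.
move=> fg.
have Efg h k : (forall x, X x -> sat (atom_sat M x) h = sat (atom_sat M x) k) ->
    E h = E h * E k.
  move=> hk; apply/eqP; rewrite -subr_eq0 -{1}[E h]mulr1 -mulrBr; apply/eqP.
  apply: (eval_unsat (f := BAnd h (BNot k))) => x xX /=.
  by rewrite hk// andbN.
by rewrite (Efg f g fg) eval_comm -Efg// => x /fg.
Qed.

Definition sat_set (f : formula) : set (nat -> I) :=
  [set x | X x /\ sat (atom_sat M x) f].

Lemma sat_setT : sat_set btrue = X.
Proof. by apply/seteqP; split=> x // []. Qed.

Lemma sat_set0 : sat_set (BNot btrue) = set0.
Proof. by apply/seteqP; split=> x // []. Qed.

Lemma sat_setI f g : sat_set f `&` sat_set g = sat_set (BAnd f g).
Proof.
apply/seteqP; rewrite /sat_set; split=> x /=.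
  by move=> [[xX ->] [_ ->]].
by move=> [xX /andP[]].
Qed.

Lemma sat_setD f : X `\` sat_set f = sat_set (BNot f).
Proof.
apply/seteqP; rewrite /sat_set; split=> x /= [xX h]; split=> //.
  by apply/negP => fx; apply: h.
by move=> [_]; exact/negP.
Qed.

Lemma sat_setU f g :
  sat_set f `|` sat_set g = sat_set (BNot (BAnd (BNot f) (BNot g))).
Proof.
apply/seteqP; rewrite /sat_set; split=> x /=; rewrite negb_and !negbK.
  by move=> [[xX ->]|[xX ->]]; rewrite ?orbT.
by move=> [xX /orP[]]; [left|right].
Qed.

(** The value at sets not defined by a formula is arbitrary; by
    [subshift_algebra_sat] there are none in the algebra of the subshift. *)
Definition set_elt (C : set (nat -> I)) : B :=
  if pselect (exists f, C = sat_set f) is left e then E (projT1 (cid e)) else 0.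

Lemma set_eltE f : set_elt (sat_set f) = E f.
Proof.
rewrite /set_elt; case: pselect => [e|]; last by case; exists f.
case: cid => g /= fg; apply: eval_ext => x xX.
have /propeqP := congr1 (fun C : set (nat -> I) => C x) fg.
by move=> [fgx gfx]; apply/idP/idP => h; [have [] := gfx|have [] := fgx].
Qed.

Lemma subshift_algebra_sat C : subshift_algebra X C -> exists f, C = sat_set f.
Proof.
move=> /(_ [set C | exists f, C = sat_set f]); apply; split.
- split.
  + by move=> _ [f ->] x [].
  + by split;
      [exists (BNot btrue); rewrite sat_set0|exists btrue; rewrite sat_setT].
  + by move=> _ _ [f ->] [g ->]; exists (BAnd f g); rewrite sat_setI.
  + move=> _ _ [f ->] [g ->]; exists (BNot (BAnd (BNot f) (BNot g))).
    by rewrite sat_setU.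
  + by move=> _ [f ->]; exists (BNot f); rewrite sat_setD.
- move=> _ [al [be [/language_sorted aS _ ->]]].
  by exists (BVar (olast al, be)); rewrite (cylinderE _ aS).
Qed.

(** Admissibility makes the initial projection of each letter absorb the next
    letter, so that only the last one survives. *)
Lemma word_prod_olast w : sorted M w ->
  star (word_prod T w) * word_prod T w = atom_elt_rec (olast w) [::].
Proof.
rewrite /word_prod; elim: w => [|a w IH]; first by rewrite big_nil star1 mulr1.
case: w IH => [|b w] IH; first by rewrite big_seq1.
move=> /= /andP[ab bw]; rewrite -[RHS](IH bw) big_cons star_mul.
have QW : Q a * \prod_(i <- b :: w) T i = \prod_(i <- b :: w) T i.
  by rewrite big_cons mulrA source_mul ab.
by rewrite -mulrA (mulrA (star (T a))) QW.
Qed.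

Lemma word_prod_conj r w :
  word_prod T w * atom_elt_rec r [::] * star (word_prod T w) = atom_elt_rec r w.
Proof.
rewrite /word_prod; elim: w => [|a w IH].
  by rewrite big_nil star1 mul1r mulr1.
by rewrite big_cons star_mul [RHS]/= -IH !mulrA.
Qed.

Lemma EL_subshift_family : subshift_family X set_elt T.
Proof.
split.
- move=> _ /subshift_algebra_sat[f ->]; rewrite set_eltE.
  by split; [exact: eval_star|exact: eval_idem].
- exact: (EL_isometry elT).
- by rewrite -[X in set_elt X]sat_setT set_eltE.
- move=> _ _ /subshift_algebra_sat[f ->] /subshift_algebra_sat[g ->].
  by rewrite sat_setI !set_eltE.
- move=> _ _ /subshift_algebra_sat[f ->] /subshift_algebra_sat[g ->].
  rewrite sat_setI sat_setU !set_eltE /= mulrBr mulr1 mulrBl mul1r.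
  by rewrite !opprB addrC (addrA _ (E f)) subrK addrC addrA.
- by rewrite -sat_set0 set_eltE /= subrr.
- move=> al be /language_sorted aS _; rewrite (cylinderE _ aS).
  rewrite -[LHS]mulrA mulrA -[_ * _ * word_prod T al]mulrA.
  rewrite word_prod_olast// word_prod_conj.
  by rewrite -[LHS]/(E (BVar (olast al, be))) -set_eltE.
Qed.

End ExelLacaToSubshift.

(** * The Boolean algebra of a subshift *)

Section SubshiftAlgebra.
Variables (I : Type) (X : set (nat -> I)).

Lemma subshift_algebra_closed :
  boolean_algebra_of_subsets X (subshift_algebra X).
Proof.
split.
- move=> B; apply; split; last by move=> _ [al [be [_ _ ->]]] x [].
  split; first by [].
  + by split; [exact: sub0set|exact: subset_refl].
  + by move=> C D CX _ x [/CX].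
  + by move=> C D CX DX x [/CX|/DX].
  + by move=> C CX x [].
- by split=> F [[_ [F0 FX] _ _ _] _].
- move=> B C XB XC F FP; have [[_ _ FI _ _] _] := FP.
  by apply: FI; [exact: XB|exact: XC].
- move=> B C XB XC F FP; have [[_ _ _ FU _] _] := FP.
  by apply: FU; [exact: XB|exact: XC].
- move=> B XB F FP; have [[_ _ _ _ FD] _] := FP.
  by apply: FD; exact: XB.
Qed.

Lemma subshift_algebra_cylinder al be : language X al -> language X be ->
  subshift_algebra X (cylinder X al be).
Proof. by move=> aX bX F [_]; apply; exists al, be. Qed.

Lemma subshift_algebra_sub C : subshift_algebra X C -> C `<=` X.
Proof. by case: subshift_algebra_closed => h _ _ _ _ /h. Qed.

End SubshiftAlgebra.

Section SubshiftFamily.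
Variables (R : realType) (I : choiceType) (X : set (nat -> I)).
Variables (B : unitalCstarAlgType R) (p : set (nat -> I) -> B) (s : I -> B).
Hypothesis ps : subshift_family X p s.

Lemma subshift_pD C : subshift_algebra X C -> p (X `\` C) = 1 - p C.
Proof.
move=> XC; have [_ _ _ _ XD] := subshift_algebra_closed X.
have := subshift_pU ps XC (XD _ XC).
rewrite setDIK (subshift_p0 ps) subr0 setDUK ?(subshift_pT ps); last first.
  exact: subshift_algebra_sub.
by move=> ->; rewrite addrC addKr.
Qed.

(** The projections indexed by cylinders are words in the [s a] and their
    adjoints, and the other projections are obtained from these by Boolean
    operations. *)
Lemma star_hom_eq_on_sets (D : unitalCstarAlgType R) (f g : B -> D) :
  star_hom f -> star_hom g -> (forall a, f (s a) = g (s a)) ->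
  forall C, subshift_algebra X C -> f (p C) = g (p C).
Proof.
move=> fH gH fg C XC.
suff [] : subshift_algebra X C /\ f (p C) = g (p C) by [].
have [XX [X0 XT] XI XU XD] := subshift_algebra_closed X.
have fw w : f (word_prod s w) = g (word_prod s w).
  rewrite !star_hom_word//; congr word_prod; exact/funext.
apply: (XC [set C | subshift_algebra X C /\ f (p C) = g (p C)]); split.
- split.
  + by move=> F [/XX].
  + by split; split; rewrite ?(subshift_p0 ps) ?(subshift_pT ps)
      ?star_hom0 ?star_hom1.
  + move=> F G [XF Ff] [XG Gg]; split; first exact: XI.
    by rewrite (subshift_pI ps)// (star_homM fH) (star_homM gH) Ff Gg.
  + move=> F G [XF Ff] [XG Gg]; split; first exact: XU.
    rewrite (subshift_pU ps)// (subshift_pI ps)//.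
    rewrite (star_homB fH) (star_homB gH) (star_homD fH) (star_homD gH).
    by rewrite (star_homM fH) (star_homM gH) Ff Gg.
  + move=> F [XF Ff]; split; first exact: XD.
    by rewrite subshift_pD// (star_homB fH) (star_homB gH)
      (star_hom1 fH) (star_hom1 gH) Ff.
- move=> _ [al [be [aX bX ->]]]; split; first exact: subshift_algebra_cylinder.
  by rewrite -(subshift_word ps)// !(star_homM fH, star_homM gH)
    !(star_hom_star fH) !(star_hom_star gH) !fw.
Qed.

End SubshiftFamily.

(** * The Exel-Laca family of a subshift family *)

Section SubshiftToExelLaca.
Variables (R : realType) (I : choiceType) (M : I -> I -> bool).
Variables (B : unitalCstarAlgType R) (p : set (nat -> I) -> B) (s : I -> B).
Hypothesis no_zero_row : forall i, exists j, M i j.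
Local Notation X := (matrix_shift M).
Hypothesis ps : subshift_family X p s.

Definition letter_set (P : I -> bool) : set (nat -> I) :=
  [set x | X x /\ P (x 0%N)].

Lemma letter_setI P P' :
  letter_set P `&` letter_set P' = letter_set (fun i => P i && P' i).
Proof.
rewrite /letter_set; apply/seteqP; split=> x /=.
  by move=> [[xX ->] [_ ->]].
by move=> [xX /andP[]].
Qed.

Lemma letter_setU P P' :
  letter_set P `|` letter_set P' = letter_set (fun i => P i || P' i).
Proof.
rewrite /letter_set; apply/seteqP; split=> x /=.
  by move=> [[xX ->]|[xX ->]]; rewrite ?orbT.
by move=> [xX /orP[]]; [left|right].
Qed.

Lemma letter_setD P : X `\` letter_set P = letter_set (fun i => ~~ P i).
Proof.
apply/seteqP; rewrite /letter_set; split=> x /= [xX h]; split=> //.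
  by apply/negP => fx; apply: h.
by move=> [_]; exact/negP.
Qed.

Lemma letter_set0 : letter_set xpred0 = set0.
Proof. by apply/seteqP; split=> x // []. Qed.

Lemma letter_setT : letter_set xpredT = X.
Proof. by apply/seteqP; split=> x // []. Qed.

Lemma source_cylinder i : cylinder X [:: i] [::] = letter_set (M i).
Proof. exact: cylinderE. Qed.

Lemma range_cylinder i : cylinder X [::] [:: i] = letter_set (pred1 i).
Proof.
rewrite (cylinderE (M := M))// /atom_set /letter_set.
by apply/seteqP; split=> x /=; rewrite andbT.
Qed.

Lemma letter_set_source i : subshift_algebra X (letter_set (M i)).
Proof.
rewrite -source_cylinder; apply: subshift_algebra_cylinder; last by left.
exact: language_letter.
Qed.

Lemma letter_set_range i : subshift_algebra X (letter_set (pred1 i)).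
Proof.
rewrite -range_cylinder; apply: subshift_algebra_cylinder; first by left.
exact: language_letter.
Qed.

Lemma source_proj i : star (s i) * s i = p (letter_set (M i)).
Proof.
rewrite -source_cylinder -(subshift_word ps); last by left.
  by rewrite /word_prod big_nil big_seq1 star1 mul1r mulr1.
exact: language_letter.
Qed.

Lemma range_proj i : s i * star (s i) = p (letter_set (pred1 i)).
Proof.
rewrite -range_cylinder -(subshift_word ps); first last.
- exact: language_letter.
- by left.
by rewrite /word_prod big_nil big_seq1 star1 !mulr1.
Qed.

(** The left-hand side of (EL4), for lists in place of finite sets so as to argue
    by induction. *)
Lemma source_prod (u v : seq I) :
  let P j := all (M^~ j) u && all (fun y => ~~ M y j) v in
  subshift_algebra X (letter_set P) /\
  \prod_(x <- u) (star (s x) * s x) * \prod_(y <- v) (1 - star (s y) * s y)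
    = p (letter_set P).
Proof.
have [_ [X0 XT] XI XU XD] := subshift_algebra_closed X.
elim: u => [|i u [IHX IHp]] /=.
  rewrite big_nil mul1r; elim: v => [|i v [IHX IHp]] /=.
    by rewrite big_nil -(subshift_pT ps) letter_setT.
  have XMi := letter_set_source i.
  rewrite big_cons IHp source_proj -(subshift_pD ps)// letter_setD.
  have XMi' : subshift_algebra X (letter_set (fun j => ~~ M i j)).
    by rewrite -letter_setD; exact: XD.
  by rewrite -(subshift_pI ps)// letter_setI; split=> //;
    rewrite -letter_setI; exact: XI.
have XMi := letter_set_source i.
rewrite (_ : letter_set _ = letter_set (M i) `&`
    letter_set (fun j => all (M^~ j) u && all (fun y => ~~ M y j) v)).
  split; first exact: XI.
  by rewrite big_cons -mulrA IHp source_proj (subshift_pI ps).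
by rewrite letter_setI; congr letter_set; apply/funext => j; rewrite andbA.
Qed.

(** The sets of sequences with a given first letter are disjoint, so that the sum
    on the right-hand side of (EL4) is again a value of [p]. *)
Lemma range_sum (l : seq I) : uniq l ->
  subshift_algebra X (letter_set (mem l)) /\
  p (letter_set (mem l)) = \sum_(j <- l) s j * star (s j).
Proof.
have [_ [X0 XT] XI XU XD] := subshift_algebra_closed X.
elim: l => [_|i l IH /andP[il /IH[lX lp]]].
  rewrite big_nil (_ : letter_set _ = set0) ?(subshift_p0 ps)//.
  by rewrite -letter_set0; congr letter_set; apply/funext.
have Xi := letter_set_range i.
rewrite (_ : letter_set (mem (i :: l)) =
    letter_set (pred1 i) `|` letter_set (mem l)).
  split; first exact: XU.
  have disj : letter_set (pred1 i) `&` letter_set (mem l) = set0.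
    rewrite letter_setI -letter_set0; congr letter_set; apply/funext => j /=.
    by case: eqP => // ->; exact/negbTE.
  by rewrite (subshift_pU ps)// disj (subshift_p0 ps) subr0 lp big_cons
    range_proj.
by rewrite letter_setU; congr letter_set; apply/funext => j; rewrite inE.
Qed.

Lemma subshift_EL_family : EL_family M s.
Proof.
have [_ [X0 XT] XI XU XD] := subshift_algebra_closed X.
split.
- exact: (subshift_isometry ps).
- move=> i j; rewrite !source_proj -!(subshift_pI ps) 1?setIC//;
    exact: letter_set_source.
- move=> i j ij; rewrite !range_proj -(subshift_pI ps);
    try exact: letter_set_range.
  rewrite letter_setI (_ : letter_set _ = set0) ?(subshift_p0 ps)//.
  by apply/seteqP; split=> x // [_ /andP[/eqP -> /eqP]].
- move=> i j; rewrite source_proj range_proj -(subshift_pI ps);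
    [|exact: letter_set_source|exact: letter_set_range].
  rewrite letter_setI; case Mij: (M i j).
    congr p; apply/seteqP; split=> x [xX] /=; first by move=> /andP[].
    by move=> /eqP xj; split=> //=; rewrite xj Mij eqxx.
  rewrite (_ : letter_set _ = set0) ?(subshift_p0 ps)//.
  by apply/seteqP; split=> x // [_ /= /andP[+ /eqP xj]]; rewrite xj Mij.
- move=> U V fin; have [XP ->] := source_prod U V.
  rewrite (fsbigTE (fset_set [set j | EL_coef M U V j <> 0%N])); last first.
    move=> j; rewrite in_fset_set// notin_setE /= => /contrapT ->.
    by rewrite mulr0n.
  rewrite (_ : letter_set _ =
      letter_set (mem (fset_set [set j | EL_coef M U V j <> 0%N]))).
    rewrite (range_sum _).2 ?fset_uniq//.
    rewrite big_seq [RHS]big_seq; apply: eq_bigr => j.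
    rewrite in_fset_set// inE /= => /eqP c0.
    by move: c0; rewrite EL_coefE; case: (_ && _).
  congr letter_set; apply/funext => j; apply/idP/idP.
    by move=> jP; rewrite /= in_fset_set// inE /= EL_coefE jP.
  by rewrite /= in_fset_set// inE /= EL_coefE; case: (_ && _).
Qed.

End SubshiftToExelLaca.

(** * The isomorphism *)

Theorem proposition4p4 (R : realType) (I : choiceType) (M : I -> I -> bool)
    (no_zero_row : forall i, exists j, M i j)
    (OA : unitalCstarAlgType R) (S : I -> OA)
    (OA_universal : universal_EL M S)
    (OX : unitalCstarAlgType R) (p : set (nat -> I) -> OX) (s : I -> OX)
    (OX_universal : universal_subshift (matrix_shift M) p s) :
  star_isomorphic OA OX.
Proof.
have [SEL SU] := OA_universal; have [ps pU] := OX_universal.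
have [f [[fH fS] _]] := SU _ _ (subshift_EL_family no_zero_row ps).
have [g [[gH gp gs] _]] := pU _ _ _ (EL_subshift_family no_zero_row SEL).
exists f => //; exists g.
- have [h [_ hU]] := SU _ _ SEL.
  have h_gf : h = g \o f.
    apply: hU; split; first exact: star_hom_comp.
    by move=> i /=; rewrite fS gs.
  have h_id : h = idfun by apply: hU; split.
  by move=> x; rewrite -[g (f x)]/((g \o f) x) -h_gf h_id.
- have [h [_ hU]] := pU _ _ _ ps.
  have fg_s a : f (g (s a)) = s a by rewrite gs fS.
  have h_fg : h = f \o g.
    apply: hU; split=> //; first exact: star_hom_comp.
    exact: (star_hom_eq_on_sets ps (star_hom_comp fH gH) (star_hom_id OX)).
  have h_id : h = idfun by apply: hU; split.
  by move=> x; rewrite -[f (g x)]/((f \o g) x) -h_fg h_id.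
Qed.
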